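(* Let $X$ be a smooth Minkowski space with norm $\|\cdot\|$, and let $a_1,\dots,a_m$ be distinct non-zero points of $X$. For each $i=1,\dots,m$ let $a_i^\ast\in X^\ast$ be the (unique) norming functional of $a_i$. Then the tree with vertex set $\{0,a_1,\dots,a_m\}$ and edges $\{0,a_i\}$, $i=1,\dots,m$, is a Steiner Minimal Tree of $S=\{0,a_1,\dots,a_m\}$ if and only if $a_1^\ast,\dots,a_m^\ast$ satisfy the collapsing condition in $X^\ast$, i.e. $$\Bigl\|\sum_{i\in J}a_i^\ast\Bigr\|^\ast\le 1\quad\text{for every } J\subseteq\{1,\dots,m\}.$$
   Context: A Minkowski space is a finite-dimensional real Banach space $X$ with norm $\|\cdot\|$. Its dual $X^\ast$ is the space of linear functionals on $X$, with norm $\|x^\ast\|^\ast=\sup_{\|x\|\le 1}\langle x^\ast,x\rangle$, where $\langle x^\ast,x\rangle$ denotes $x^\ast$ applied to $x$. $X$ is smooth if $\lim_{t\to 0}\frac{\|x+th\|-\|x\|}{t}$ exists for all $x,h\in X$ with $x\ne 0$. A norming functional of a non-zero $x\in X$ is $x^\ast\in X^\ast$ with $\|x^\ast\|^\ast=1$ and $\langle x^\ast,x\rangle=\|x\|$; in a smooth space it is unique. For a finite set $S\subseteq X$, a Steiner Minimal Tree (SMT) of $S$ is a finite tree $T$ whose vertex set $V(T)$ satisfies $S\subseteq V(T)\subseteq X$ and whose total length $\sum_{\{x,y\}\in E(T)}\|x-y\|$ is minimal among all finite trees with vertex set $V$ satisfying $S\subseteq V\subseteq X$. *)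

(* Defs.v *)
From HB Require Import structures.
From mathcomp Require Import all_boot all_order all_algebra.
From mathcomp Require Import finmap.
From mathcomp Require Import all_classical all_reals all_analysis.

Set Implicit Arguments.
Unset Strict Implicit.
Unset Printing Implicit Defensive.

Import Order.TTheory GRing.Theory Num.Theory.
Import numFieldNormedType.Exports.

Local Open Scope classical_set_scope.
Local Open Scope ring_scope.

(** Completeness is not required separately: it is automatic for a
    finite-dimensional normed space over a [realType]. *)
#[short(type="minkowskiType")]
HB.structure Definition Minkowski (R : realType) :=
  {X of NormedModule R X & Vector R X}.

(** By finite dimension the set below is bounded (and it contains [f 0 = 0]), so
    this is a genuine supremum and never the default value of [sup]. *)
Definition dual_norm (R : realType) (X : minkowskiType R)
    (f : 'Hom(X, R^o)) : R :=
  sup [set (f x : R) | x in [set x : X | `|x| <= 1]].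

Definition smooth (R : realType) (X : minkowskiType R) : Prop :=
  forall x h : X, x != 0 -> derivable (fun y : X => `|y| : R^o) x h.

Definition norming_functional (R : realType) (X : minkowskiType R)
    (x : X) (f : 'Hom(X, R^o)) : Prop :=
  dual_norm f = 1 /\ f x = `|x|.

Definition collapsing (R : realType) (X : minkowskiType R) (m : nat)
    (f : 'I_m -> 'Hom(X, R^o)) : Prop :=
  forall J : {set 'I_m}, dual_norm (\sum_(i in J) f i) <= 1.

(** The adjacency relation is only meant to be read as a graph when it is
    symmetric and irreflexive, which is part of [is_tree]. *)
Record graph_in (X : choiceType) := GraphIn {
  vertices : {fset X};
  adj : rel vertices
}.

Definition is_tree (X : choiceType) (T : graph_in X) : Prop :=
  [/\ symmetric (@adj X T) /\ irreflexive (@adj X T),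
      vertices T != fset0,
      forall x y : vertices T, connect (@adj X T) x y
    & forall c : seq (vertices T), (2 < size c)%N -> ~ ucycle (@adj X T) c].

(** Each edge [{x, y}] is met twice, as [(x, y)] and as [(y, x)]. *)
Definition tree_length (R : realType) (X : minkowskiType R)
    (T : graph_in X) : R :=
  2^-1 * \sum_(x : vertices T) \sum_(y : vertices T | adj x y)
    `|val x - val y|.

Definition steiner_minimal_tree (R : realType) (X : minkowskiType R)
    (S : {fset X}) (T : graph_in X) : Prop :=
  [/\ is_tree T, (S `<=` vertices T)%fset
    & forall T' : graph_in X, is_tree T' -> (S `<=` vertices T')%fset ->
        tree_length T <= tree_length T'].

Definition star_points (R : realType) (X : minkowskiType R) (m : nat)
    (a : 'I_m -> X) : {fset X} :=
  (0 |` [fset a i | i : 'I_m])%fset.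

Definition star (R : realType) (X : minkowskiType R) (m : nat)
    (a : 'I_m -> X) : graph_in X :=
  @GraphIn X (star_points a) (fun x y =>
    [exists i, (val x == 0) && (val y == a i)
            || (val x == a i) && (val y == 0)]).

(* Main.v *)
(** If the collapsing condition holds, root a competing tree [T] at [0] and let
    [p] be a parent function. Writing each [a i] as the sum of the edge vectors
    [v - p v] over its ancestors, apply [astar i], sum over [i] and exchange the
    sums: every edge vector meets only a partial sum of the [astar i], so it
    contributes at most its length. Conversely, if some partial sum over [J]
    exceeds [`|h|] at [h], rerouting the edges [{0, a i}], [i \in J], through
    [t *: h] changes the length, by smoothness, by
    [t * (`|h| - \sum_(i in J) astar i h) + o(t)], which is negative for small
    [t > 0]. *)
Require Import Defs.
From mathcomp Require Import all_boot all_order all_algebra.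
From mathcomp Require Import finmap.
From mathcomp Require Import all_classical all_reals all_analysis.

Import GRing.Theory Num.Theory.
Import numFieldNormedType.Exports.
Local Open Scope ring_scope.

Import Order.TTheory.

Set Implicit Arguments.
Unset Strict Implicit.
Unset Printing Implicit Defensive.

(** * Rooted trees described by a parent function and a depth *)

(** The guards [x != r] and [y != r] let [p] be a total function with an arbitrary value at the
    root. *)
Definition parent_edge (V : eqType) (r : V) (p : V -> V) : rel V :=
  [rel x y | (x != r) && (y == p x) || (y != r) && (x == p y)].

Definition decreasing_parent (V : eqType) (r : V) (p : V -> V) (d : V -> nat) :=
  forall x, x != r -> (d (p x) < d x)%N.

Lemma parent_edge_sym (V : eqType) (r : V) (p : V -> V) :
  symmetric (parent_edge r p).
Proof. by move=> x y; rewrite /parent_edge/= orbC. Qed.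

Lemma parent_edge_irr (V : eqType) (r : V) (p : V -> V) (d : V -> nat) :
  decreasing_parent r p d -> irreflexive (parent_edge r p).
Proof.
move=> dp x; rewrite /parent_edge/= orbb; apply/negP => /andP[xr /eqP xE].
by have := dp _ xr; rewrite -xE ltnn.
Qed.

Lemma parent_edge_le (V : eqType) (r : V) (p : V -> V) (d : V -> nat) (x y : V) :
  decreasing_parent r p d -> parent_edge r p x y -> (d y <= d x)%N -> y = p x.
Proof.
move=> dp /orP[/andP[_ /eqP//]|/andP[yr /eqP xE]].
by have := dp _ yr; rewrite -xE ltnNge => /negbTE ->.
Qed.

Lemma parent_edge_connect (V : finType) (r : V) (p : V -> V) (d : V -> nat) :
  decreasing_parent r p d -> forall x y, connect (parent_edge r p) x y.
Proof.
move=> dp; have to_root x : connect (parent_edge r p) x r.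
  have [n] := ubnP (d x); elim: n x => // n IHn x.
  have [->|xr] := eqVneq x r; first by rewrite connect0.
  rewrite ltnS => dx; apply: (@connect_trans _ _ (p x)).
    by apply: connect1; rewrite /parent_edge/= xr eqxx.
  by apply: IHn; exact: leq_trans (dp _ xr) dx.
move=> x y; apply: connect_trans (to_root x) _.
by rewrite (sym_connect_sym (@parent_edge_sym _ r p)).
Qed.

(* The two neighbours on a cycle of a vertex of maximal depth would both be its
   parent. *)
Lemma parent_edge_acyclic (V : finType) (r : V) (p : V -> V) (d : V -> nat) :
  decreasing_parent r p d ->
  forall c, (2 < size c)%N -> ~ ucycle (parent_edge r p) c.
Proof.
move=> dp c szc /andP[cyc_c uniq_c].
have [x0 x0c] : exists x0, x0 \in c.
  by case: c szc {cyc_c uniq_c} => // x0 c _; exists x0; rewrite mem_head.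
pose z := [arg max_(z > x0 in c) d z].
have [zc zmax] : z \in c /\ {in c, forall y, (d y <= d z)%N}.
  by rewrite /z; case: arg_maxnP.
have next_par : next c z = p z.
  by apply: parent_edge_le dp _ _; [exact: next_cycle|rewrite zmax// mem_next].
have prev_par : prev c z = p z.
  apply: parent_edge_le dp _ _; last by rewrite zmax// mem_prev.
  by rewrite parent_edge_sym; exact: prev_cycle.
(* Equal neighbours give [next c (next c z) = z], whereas once [z] is rotated to the front the third
   vertex must differ from it. *)
have := next_prev uniq_c z; rewrite prev_par -next_par.
have [i c' rot_c] := rot_to zc.
rewrite -!(next_rot i uniq_c) rot_c.
have: uniq (z :: c') by rewrite -rot_c rot_uniq.
have: (2 < size (z :: c'))%N by rewrite -rot_c size_rot.
case: c' {rot_c} => [//|y [//|w c']] _ /=.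
rewrite !inE !negb_or eqxx => /andP[/and3P[zy zw _] _].
by rewrite eq_sym (negbTE zy) eqxx => wz; rewrite wz eqxx in zw.
Qed.

(** Each edge is met once from the child and once from the parent; the factor 2 cancels the [2^-1]
    of [tree_length]. *)
Lemma sum_parent_edge (R : realFieldType) (V : finType) (r : V) (p : V -> V)
    (d : V -> nat) (w : V -> V -> R) :
  decreasing_parent r p d -> (forall x y, w x y = w y x) ->
  \sum_x \sum_(y | parent_edge r p x y) w x y =
  2 * \sum_(x | x != r) w x (p x).
Proof.
move=> dp wC.
pose par x y := (x != r) && (y == p x).
have parE : \sum_x \sum_(y | par x y) w x y = \sum_(x | x != r) w x (p x).
  rewrite [RHS]big_mkcond; apply: eq_bigr => x _.
  by rewrite /par; case: (x != r) => /=; rewrite ?big_pred1_eq ?big_pred0.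
have -> : \sum_x \sum_(y | parent_edge r p x y) w x y =
    \sum_x \sum_(y | par x y) w x y + \sum_x \sum_(y | par y x) w x y.
  rewrite -big_split; apply: eq_bigr => x _ /=.
  rewrite [in LHS]big_mkcond [X in _ = X + _]big_mkcond.
  rewrite [X in _ = _ + X]big_mkcond -big_split; apply: eq_bigr => y _ /=.
  rewrite /parent_edge/= -/(par x y) -/(par y x).
  have [/andP[xr /eqP yE]|_] := ifPn (par x y); last by rewrite add0r.
  have [/andP[yr /eqP xE]|_] := ifPn (par y x); last by rewrite addr0.
  (* Two vertices cannot be each other's parent, so the two orientations are disjoint. *)
  by have := dp _ yr; have := dp _ xr; rewrite -yE -xE => /ltn_trans/[apply]; rewrite ltnn.
rewrite [X in _ + X](exchange_big_dep xpredT)//=.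
have -> : \sum_x \sum_(y | par x y) w y x = \sum_x \sum_(y | par x y) w x y.
  by apply: eq_bigr => x _; apply: eq_bigr => y _.
by rewrite parE mulr2n mulrDl !mul1r.
Qed.

(** Here [d] is the distance from [r], and [p x] is the last vertex before [x] on a shortest walk
    from [r]. *)
Lemma connected_parent (V : finType) (e : rel V) (r : V) :
  (forall x, connect e r x) ->
  exists p d, decreasing_parent r p d /\ forall x, x != r -> e (p x) x.
Proof.
move=> e_conn.
have walk x : exists n, [exists s : n.-tuple V, path e r s && (last r s == x)].
  have /connectP[s es xE] := e_conn x; exists (size s); apply/existsP.
  by exists (in_tuple s); rewrite es xE eqxx.
pose d x := ex_minn (walk x).
have d_min s : path e r s -> (d (last r s) <= size s)%N.
  move=> es; rewrite /d; case: ex_minnP => k _; apply; apply/existsP.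
  by exists (in_tuple s); rewrite es eqxx.
have d_walk x : exists s, [/\ path e r s, last r s = x & size s = d x].
  rewrite /d; case: ex_minnP => n /existsP[s /andP[es /eqP xE]] _.
  by exists s; rewrite size_tuple.
have parent x : exists y, x != r -> e y x && (d y < d x)%N.
  have [->|xr] := eqVneq x r; first by exists r.
  have [s [es xE szs]] := d_walk x.
  case/lastP: s es xE szs => [_ xE|s y]; first by rewrite -xE eqxx in xr.
  rewrite rcons_path last_rcons size_rcons => /andP[es ey] <- <-.
  by exists (last r s) => _; rewrite ey ltnS d_min.
have [p pP] := choice parent.
by exists p, d; split=> x /pP/andP[].
Qed.

(** [A] consists of [x] and its ancestors below the root, along which the differences telescope. *)
Lemma telescope_parent (V : finType) (G : zmodType) (r : V) (p : V -> V)
    (d : V -> nat) (g : V -> G) :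
  decreasing_parent r p d ->
  forall x, exists2 A : {set V}, r \notin A &
    g x - g r = \sum_(y in A) (g y - g (p y)).
Proof.
move=> dp x.
(* The added depth bound shows in the induction that [x] is not yet in the set obtained for
   [p x]. *)
suff [A [rA _ gA]] : exists A : {set V}, [/\ r \notin A,
    {in A, forall y, (d y <= d x)%N} &
    g x - g r = \sum_(y in A) (g y - g (p y))] by exists A.
have [n] := ubnP (d x); elim: n x => // n IHn x.
have [->|xr] := eqVneq x r.
  exists finset.set0; split=> [|y|]; rewrite ?inE//.
  by rewrite big_set0 subrr.
rewrite ltnS => dx.
have [A [rA dA gA]] := IHn _ (leq_trans (dp _ xr) dx).
exists (x |: A)%SET; split.
- by rewrite !inE negb_or eq_sym xr.
- move=> y; rewrite !inE => /predU1P[->//|/dA dy].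
  exact: leq_trans dy (ltnW (dp _ xr)).
- rewrite big_setU1/=; last by apply/negP => /dA; rewrite leqNgt dp.
  by rewrite -gA addrA subrK.
Qed.

Lemma parent_graph (R : realType) (X : minkowskiType R) (T : graph_in X)
    (r : X) (p : X -> X) (d : X -> nat) :
  r \in vertices T ->
  (forall x, x \in vertices T -> x != r ->
     p x \in vertices T /\ (d (p x) < d x)%N) ->
  (forall x y : vertices T, adj x y = parent_edge r p (val x) (val y)) ->
  is_tree T /\ tree_length T = \sum_(x <- vertices T | x != r) `|x - p x|.
Proof.
move=> rV pV adjE.
pose r' : vertices T := FSetSub rV.
(* The default [r'] can only be taken at the root, where [p] may leave the vertex set. *)
pose p' (x : vertices T) : vertices T := insubd r' (p (val x)).
pose d' (x : vertices T) := d (val x).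
have p'E x : x != r' -> val (p' x) = p (val x).
  by move=> xr; rewrite val_insubd (pV _ (valP x) xr).1.
have dp' : decreasing_parent r' p' d'.
  by move=> x xr; rewrite /d' p'E//; exact: (pV _ (valP x) xr).2.
have adjE' : @adj X T =2 parent_edge r' p'.
  move=> x y; rewrite adjE /parent_edge/= -!(inj_eq val_inj) /=.
  have [xr|xr] := eqVneq x r'; have [yr|yr] := eqVneq y r'.
  - by rewrite xr yr eqxx.
  - by rewrite xr eqxx/= p'E.
  - by rewrite yr eqxx/= p'E.
  - by rewrite !p'E.
split.
- split.
  + split=> [x y|x]; first by rewrite !adjE' parent_edge_sym.
    by rewrite adjE' (parent_edge_irr dp').
  + by apply/fset0Pn; exists r.
  + by move=> x y; rewrite (eq_connect adjE'); exact: parent_edge_connect dp' _ _.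
  + move=> c szc /andP[cyc_c uc]; apply: (parent_edge_acyclic dp' szc).
    by rewrite /ucycle uc andbT -(eq_cycle adjE').
- rewrite /tree_length.
  under eq_bigr do under eq_bigl do rewrite adjE'.
  rewrite (sum_parent_edge dp'); last by move=> x y; rewrite distrC.
  rewrite mulKf ?pnatr_eq0// big_seq_fsetE /=.
  by apply: eq_bigr => x xr; rewrite p'E.
Qed.

(** * Dual norm, norming functionals and smoothness *)

(** The bound [C] makes the supremum genuine; the rest is scaling [x] to norm 1. *)
Lemma le_dual_norm (R : realType) (X : minkowskiType R) (f : 'Hom(X, R^o))
    (C : R) :
  (forall x, `|x| <= 1 -> (f x : R) <= C) ->
  forall x, (f x : R) <= dual_norm f * `|x|.
Proof.
move=> fC x; have [->|x0] := eqVneq x 0; first by rewrite linear0 normr0 mulr0.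
have nx : 0 < `|x| by rewrite normr_gt0.
rewrite -ler_pdivrMr// mulrC.
rewrite (_ : _ * _ = f (`|x|^-1 *: x)); last by rewrite linearZ.
apply: ub_le_sup; first by exists C => _ [y /= y1 <-]; exact: fC.
exists (`|x|^-1 *: x) => //=.
by rewrite normrZ normfV normr_id mulVf// gt_eqF.
Qed.

Lemma norming_le (R : realType) (X : minkowskiType R) (x : X)
    (f : 'Hom(X, R^o)) :
  norming_functional x f -> forall y, (f y : R) <= `|y|.
Proof.
move=> [f1 _] y.
(* Without a genuine supremum [sup] would take its default value 0, but the dual norm is 1. *)
have [_ [C fC]] : has_sup [set (f x : R) | x in [set x : X | `|x| <= 1]]%classic.
  apply: contrapT => /sup_out f0; move: f1; rewrite /dual_norm f0 => /esym/eqP.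
  by rewrite oner_eq0.
rewrite -[leRHS]mul1r -f1; apply: (@le_dual_norm _ _ _ C) => z z1.
by apply: fC; exists z.
Qed.

Lemma dual_norm_le1P (R : realType) (X : minkowskiType R) (f : 'Hom(X, R^o))
    (C : R) :
  (forall x, `|x| <= 1 -> (f x : R) <= C) ->
  dual_norm f <= 1 <-> forall x, (f x : R) <= `|x|.
Proof.
move=> fC; split=> [f1 x|fle].
  by rewrite (le_trans (le_dual_norm fC x))// ler_piMl.
apply: ge_sup; first by exists (f 0); exists 0 => //=; rewrite normr0.
by move=> _ [x /= x1 <-]; exact: le_trans (fle x) x1.
Qed.

(** This pointwise form of the collapsing condition serves both implications. On the unit ball each
    [f i] is at most 1, so the number of elements of [J] bounds the sum. *)
Lemma sum_norming_le1P (R : realType) (X : minkowskiType R) (m : nat)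
    (a : 'I_m -> X) (f : 'I_m -> 'Hom(X, R^o)) (J : {set 'I_m}) :
  (forall i, norming_functional (a i) (f i)) ->
  dual_norm (\sum_(i in J) f i) <= 1 <->
  forall x, \sum_(i in J) (f i x : R) <= `|x|.
Proof.
move=> fP; have -> : (forall x, \sum_(i in J) (f i x : R) <= `|x|) <->
    forall x, ((\sum_(i in J) f i) x : R) <= `|x|.
  by split=> fle x; have := fle x; rewrite sum_lfunE.
apply: (@dual_norm_le1P _ _ _ (\sum_(i in J) 1)) => x x1; rewrite sum_lfunE.
by apply: ler_sum => i _; exact: le_trans (norming_le (fP i) x) x1.
Qed.

(* For [t < 0] the difference quotient of the norm at [x] is at most [f h],
   because [f] is dominated by the norm and agrees with it at [x]; by smoothness
   the same bound holds for the limit as [t] decreases to [0]. *)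
Lemma smooth_norm_lt (R : realType) (X : minkowskiType R) (x h : X)
    (f : 'Hom(X, R^o)) (c : R) :
  smooth X -> x != 0 -> norming_functional x f -> (f h : R) < c ->
  \forall t \near (0 : R)^'+%classic, `|t *: h + x| < `|x| + t * c.
Proof.
move=> smoothX x0 fP fc.
have /cvg_ex[/= l ql] := smoothX x h x0.
have lf : l <= f h.
  apply: (cvgr_to_le (cvg_dnbhs_at_left ql)).
  near=> t; have t0 : t < 0 by near: t; exact: nbhs_left_lt.
  rewrite /GRing.scale/= mulrC ler_ndivrMr// lerBrDr.
  have := norming_le fP (t *: h + x).
  by rewrite linearD linearZ/= fP.2 mulrC.
have qc : \forall t \near (0 : R)^'+%classic,
    t^-1 * (`|t *: h + x| - `|x|) < c.
  by apply: (cvgr_lt _ (cvg_dnbhs_at_right ql)); exact: le_lt_trans fc.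
apply: filterS2 (nbhs_right_gt (0 : R)) qc => t t0.
by rewrite mulrC ltr_pdivrMr// ltrBlDr (addrC (c * t)) (mulrC c).
Unshelve. all: by end_near.
Qed.

(** * The star and its detour through one Steiner point *)

Lemma sum_star_points (R : realType) (X : minkowskiType R) (m : nat)
    (a : 'I_m -> X) (F : X -> R) :
  injective a -> (forall i, a i != 0) ->
  \sum_(x <- star_points a | x != 0) F x = \sum_i F (a i).
Proof.
move=> a_inj a_neq0; rewrite big_mkcond /star_points big_fsetU1/=; last first.
  by apply/imfsetP => -[i _ /esym/eqP]; rewrite (negbTE (a_neq0 i)).
rewrite eqxx add0r big_imfset/=; last by move=> i j _ _; exact: a_inj.
rewrite big_enum/=; apply: eq_bigr => i _; by rewrite a_neq0.
Qed.

Lemma star_tree (R : realType) (X : minkowskiType R) (m : nat) (a : 'I_m -> X) :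
  injective a -> (forall i, a i != 0) ->
  is_tree (star a) /\ tree_length (star a) = \sum_i `|a i|.
Proof.
move=> a_inj a_neq0.
(* All parents are [0], and the boolean [x != 0], read as a number, is the depth. *)
have [|x _ x0||treeT ->] :=
  @parent_graph R X (star a) 0 (fun=> 0) (fun x => (x != 0)).
- exact: fset1U1.
- by rewrite eqxx x0 fset1U1.
- move=> x y; rewrite /parent_edge/=; apply/existsP/orP => [[i]|].
    by case/orP=> /andP[/eqP -> /eqP ->]; rewrite eqxx a_neq0; [right|left].
  have star_pt (z : vertices (star a)) : val z != 0 -> exists i, val z = a i.
    case/fset1UP: (valP z) => [->|/imfsetP[i _ ->] _]; first by rewrite eqxx.
    by exists i.
  by case=> /andP[/star_pt[i ->] /eqP ->]; exists i; rewrite !eqxx ?orbT.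
- split=> //; rewrite sum_star_points//; apply: eq_bigr => i _.
  by rewrite subr0.
Qed.

Definition detour_parent (R : realType) (X : minkowskiType R) (m : nat)
    (a : 'I_m -> X) (J : {set 'I_m}) (s x : X) : X :=
  if [exists i in J, x == a i] then s else 0.

(* The star in which the edges [{0, a i}], [i \in J], are rerouted through the
   additional Steiner point [s]. *)
Definition detour_star (R : realType) (X : minkowskiType R) (m : nat)
    (a : 'I_m -> X) (J : {set 'I_m}) (s : X) : graph_in X :=
  @GraphIn X (s |` star_points a)%fset
    (fun x y => parent_edge 0 (detour_parent a J s) (val x) (val y)).

Lemma detour_star_tree (R : realType) (X : minkowskiType R) (m : nat)
    (a : 'I_m -> X) (J : {set 'I_m}) (s : X) :
  injective a -> (forall i, a i != 0) -> s != 0 -> (forall i, s != a i) ->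
  is_tree (detour_star a J s) /\
  tree_length (detour_star a J s) =
    `|s| + \sum_i (if i \in J then `|a i - s| else `|a i|).
Proof.
move=> a_inj a_neq0 s0 sa.
have parent_a i : detour_parent a J s (a i) = if i \in J then s else 0.
  rewrite /detour_parent; congr (if _ then _ else _).
  apply/existsP/idP => [[j /andP[jJ /eqP/a_inj ->//]]|iJ].
  by exists i; rewrite iJ eqxx.
have T0 : 0 \in vertices (detour_star a J s) by rewrite !inE eqxx orbT.
have parent_s : detour_parent a J s s = 0.
  by rewrite /detour_parent; case: existsP => // -[i /andP[_]]; rewrite (negbTE (sa i)).
(* The depth only has to decrease towards the root, so every [a i] may get 2, even when its parent
   is [0]. *)
have [|x xT x0|//|treeT ->] := @parent_graph R X (detour_star a J s) 0
    (detour_parent a J s) 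
    (fun x => if x == 0 then 0%N else if x == s then 1%N else 2%N).
- exact: T0.
- move: xT x0 => /fset1UP[->|/fset1UP[->|/imfsetP[i _ ->] _]].
  + by rewrite parent_s !eqxx (negbTE s0).
  + by rewrite eqxx.
  + rewrite parent_a (negbTE (a_neq0 i)) [a i == s]eq_sym (negbTE (sa i)).
    case: ifP => _; first by rewrite !eqxx (negbTE s0) fset1U1.
    by rewrite eqxx.
- split=> //; rewrite big_mkcond big_fsetU1/=; last first.
    apply/fset1UP => -[/eqP|/imfsetP[i _ /eqP]]; first by rewrite (negbTE s0).
    by rewrite (negbTE (sa i)).
  rewrite s0 parent_s subr0 -big_mkcond/= sum_star_points//; congr +%R.
  by apply: eq_bigr => i _; rewrite parent_a; case: ifP => // _; rewrite subr0.
Qed.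

(** * The two implications between minimality and collapsing *)

Lemma collapsing_star_min (R : realType) (X : minkowskiType R) (m : nat)
    (a : 'I_m -> X) (f : 'I_m -> 'Hom(X, R^o)) (T : graph_in X) :
  (forall i, norming_functional (a i) (f i)) -> collapsing f ->
  is_tree T -> (star_points a `<=` vertices T)%fset ->
  \sum_i `|a i| <= tree_length T.
Proof.
move=> fP fJ [[T_sym _] _ T_conn _] aT.
have r_in : 0 \in vertices T by apply: (fsubsetP aT); exact: fset1U1.
have a_in i : a i \in vertices T.
  by apply: (fsubsetP aT); rewrite fset1Ur// in_imfset.
pose r : vertices T := FSetSub r_in.
have [p [d [dp pT]]] := connected_parent (T_conn r).
pose e (v : vertices T) : X := val v - val (p v).
have anc i : exists A : {set vertices T},
    r \notin A /\ a i = \sum_(v in A) e v.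
  have [A rA aA] := telescope_parent val dp (FSetSub (a_in i)).
  by exists A; rewrite -aA/= subr0.
have [A AP] := choice anc.
(* Each [a i] has norm [f i (a i)]; expanding over [A i] and exchanging sums collects, at each [v],
   the indices whose path to the root uses the edge above [v]. *)
have -> : \sum_i `|a i| = \sum_(v | v != r) \sum_(i | v \in A i) (f i (e v) : R).
  rewrite (exchange_big_dep xpredT)//=; apply: eq_bigr => i _.
  have [rA aA] := AP i; rewrite -(fP i).2 aA linear_sum/=.
  apply: eq_bigl => v; have [->|//] := eqVneq v r; exact/negbTE.
apply: (@le_trans _ _ (\sum_(v | v != r) `|e v|)).
  apply: ler_sum => v _; pose J := finset (fun i => v \in A i).
  rewrite (eq_bigl (fun i => i \in J)); last by move=> i; rewrite inE.
  exact: (sum_norming_le1P J fP).1 (fJ J) (e v).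
(* The parent edges all belong to [T], so their total length is at most that of [T]. *)
rewrite /tree_length ler_pdivlMl//.
rewrite -(@sum_parent_edge _ _ r p d (fun x y => `|val x - val y|))//; last first.
  by move=> x y; rewrite distrC.
apply: ler_sum => x _; rewrite big_mkcond [leRHS]big_mkcond.
apply: ler_sum => y _; case: ifPn => [|_]; last by case: ifP.
by case/orP=> /andP[/pT + /eqP ->]; rewrite 1?T_sym => ->.
Qed.

Lemma star_min_collapsing (R : realType) (X : minkowskiType R) (m : nat)
    (a : 'I_m -> X) (f : 'I_m -> 'Hom(X, R^o)) :
  smooth X -> injective a -> (forall i, a i != 0) ->
  (forall i, norming_functional (a i) (f i)) ->
  steiner_minimal_tree (star_points a) (star a) -> collapsing f.
Proof.
move=> smoothX a_inj a_neq0 fP [_ _ star_min] J.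
apply/(sum_norming_le1P _ fP) => h; rewrite leNgt; apply/negP => hJ.
have h0 : h != 0.
  apply: contraTneq hJ => ->; rewrite normr0 -leNgt.
  by rewrite big1// => i _; rewrite linear0.
pose S := \sum_(i in J) (f i h : R).
(* [k] is the error allowed per rerouted edge in the first-order estimate; all errors together must
   stay below the gain [S - |h|]. Dividing by [#|J|.+1] gives strictness and covers empty [J]. *)
have [k k_gt0 kJ] : exists2 k, 0 < k & #|J|%:R * k < S - `|h|.
  exists ((S - `|h|) / #|J|.+1%:R); first by rewrite divr_gt0// subr_gt0.
  by rewrite mulrCA gtr_pMr ?subr_gt0// ltr_pdivrMr// mul1r ltr_nat.
have near_t : \forall t \near (0 : R)^'+%classic, forall i,
    `|t *: (- h) + a i| < `|a i| + t * (k - f i h).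
  apply: filter_forall => i; apply: smooth_norm_lt (fP i) _ => //.
  by rewrite linearN addrC ltrDl.
(* This keeps the Steiner point [t *: h] distinct from every [a i]. *)
have near_a : \forall t \near (0 : R)^'+%classic, forall i, t * `|h| < `|a i|.
  apply: filter_forall => i; near=> t.
  rewrite -ltr_pdivlMr ?normr_gt0//; near: t; apply: nbhs_right_lt.
  by rewrite divr_gt0 ?normr_gt0.
near ((0 : R)^'+)%classic => t.
have t0 : 0 < t by near: t; exact: nbhs_right_gt.
have ta i : t * `|h| < `|a i| by move: i; near: t.
have t_norm i : `|t *: (- h) + a i| < `|a i| + t * (k - f i h).
  by move: i; near: t.
have nth : `|t *: h| = t * `|h| by rewrite normrZ gtr0_norm.
have [||treeT lenT] := @detour_star_tree R X m a J (t *: h) a_inj a_neq0.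
- by rewrite scaler_eq0 negb_or h0 gt_eqF.
- by move=> i; apply: contraTneq (ta i) => <-; rewrite nth ltxx.
have := star_min _ treeT (fsubsetU1 _ _).
rewrite lenT (star_tree a_inj a_neq0).2 leNgt => /negP; apply.
rewrite nth.
apply: (@le_lt_trans _ _ (t * `|h| + \sum_i (`|a i| +
    if i \in J then t * (k - f i h) else 0))).
  rewrite lerD2l; apply: ler_sum => i _; case: ifP => _; last by rewrite addr0.
  by rewrite ltW// (le_lt_trans _ (t_norm i))// scalerN addrC.
(* With the star's length and the factor [t] removed, what remains is [|h| + #|J| * k - S < 0],
   which is the choice of [k]. *)
rewrite big_split/= -big_mkcond/= addrCA gtrDl -mulr_sumr -mulrDr pmulr_rlt0//.
rewrite sumrB sumr_const -mulr_natl addrA -/S; move: kJ.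
by rewrite subr_lt0 ltrBrDl.
Unshelve. all: by end_near.
Qed.

Theorem theorem2 (R : realType) (X : minkowskiType R) (smoothX : smooth X)
    (m : nat) (a : 'I_m -> X) (a_inj : injective a)
    (a_neq0 : forall i : 'I_m, a i != 0)
    (astar : 'I_m -> 'Hom(X, R^o))
    (astarP : forall i : 'I_m, norming_functional (a i) (astar i)) :
  steiner_minimal_tree (star_points a) (star a) <-> collapsing astar.
Proof.
split; first exact: star_min_collapsing.
move=> collapse; have [treeS lenS] := star_tree a_inj a_neq0.
split=> //.
by move=> T treeT aT; rewrite lenS; exact: collapsing_star_min collapse treeT aT.
Qed.
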